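(* Let $G$ be a finite group. Then $d^\otimes(G)\le d^\wedge(G)\le d(G)$.
   Context: All groups are finite. For elements of a group write ${}^{x}y=xyx^{-1}$ and $[x,y]=xyx^{-1}y^{-1}$. The nonabelian tensor square $G\otimes G$ of a group $G$ is the group generated by the symbols $g\otimes h$ ($g,h\in G$) with defining relations $xy\otimes h=({}^{x}y\otimes{}^{x}h)(x\otimes h)$ and $x\otimes hk=(x\otimes h)({}^{h}x\otimes{}^{h}k)$ for all $x,y,h,k\in G$. The subgroup $\nabla(G)=\langle x\otimes x\mid x\in G\rangle$ is central in $G\otimes G$; the nonabelian exterior square is $G\wedge G=(G\otimes G)/\nabla(G)$, and $x\wedge y$ denotes the coset $(x\otimes y)\nabla(G)$. The tensor degree is $d^\otimes(G)=|\{(x,y)\in G\times G\mid x\otimes y=1_{G\otimes G}\}|/|G|^2$, the exterior degree is $d^\wedge(G)=|\{(x,y)\in G\times G\mid x\wedge y=1_{G\wedge G}\}|/|G|^2$, and the commutativity degree is $d(G)=|\{(x,y)\in G\times G\mid [x,y]=1\}|/|G|^2$. *)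

(* Defs.v *)
From HB Require Import structures.
From mathcomp Require Import all_boot all_order all_algebra all_fingroup.
From mathcomp Require Import generic_quotient boolp.

Set Implicit Arguments.
Unset Strict Implicit.
Unset Printing Implicit Defensive.

Import Order.TTheory GRing.Theory Num.Theory.

Local Open Scope quotient_scope.
Local Open Scope group_scope.

(* Left conjugation ^x y and the commutator [x, y] = x y x^-1 y^-1; MathComp's
   x ^ y and [~ x, y] follow the opposite (right-handed) convention. *)
Definition lconjg (G : groupType) (x y : G) : G := x * y * x^-1.
Definition lcommg (G : groupType) (x y : G) : G := x * y * x^-1 * y^-1.

Section Presentation.

(* A letter (x, false) stands for the generator x, and (x, true) for x^-1. *)
Definition word (X : choiceType) : choiceType := seq (X * bool)%type.

Variables (X : choiceType) (R : word X -> word X -> Prop).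
Implicit Types u v w : word X.

(* The least congruence on words that contains the defining relations R and
   the free cancellations x x^-1 = x^-1 x = 1. *)
Inductive pres_cong : word X -> word X -> Prop :=
| PresRel u v : R u v -> pres_cong u v
| PresCancel x b : pres_cong [:: (x, b); (x, ~~ b)] [::]
| PresRefl u : pres_cong u u
| PresSym u v : pres_cong u v -> pres_cong v u
| PresTrans u v w : pres_cong u v -> pres_cong v w -> pres_cong u w
| PresCat u u' v v' :
    pres_cong u u' -> pres_cong v v' -> pres_cong (u ++ v) (u' ++ v').

Definition pres_eq : rel (word X) := fun u v => `[< pres_cong u v >].

Lemma pres_eq_refl : reflexive pres_eq.
Proof. by move=> u; apply/asboolP/PresRefl. Qed.

Lemma pres_eq_sym : symmetric pres_eq.
Proof. by move=> u v; apply/asboolP/asboolP => /PresSym. Qed.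

Lemma pres_eq_trans : transitive pres_eq.
Proof.
by move=> v u w /asboolP uv /asboolP vw; apply/asboolP/(PresTrans uv vw).
Qed.

Canonical pres_equiv := EquivRel pres_eq pres_eq_refl pres_eq_sym pres_eq_trans.

Definition presented := {eq_quot pres_equiv}.
HB.instance Definition _ := Choice.on presented.
HB.instance Definition _ := EqQuotient.on presented.

Definition pres_pi u : presented := \pi_presented u.

Definition winv u : word X := rev [seq (l.1, ~~ l.2) | l <- u].

Definition pres_mul (a b : presented) : presented := pres_pi (repr a ++ repr b).
Definition pres_one : presented := pres_pi [::].
Definition pres_inv (a : presented) : presented := pres_pi (winv (repr a)).

Lemma pres_piP u v : pres_pi u = pres_pi v <-> pres_cong u v.
Proof.
split; first by move/eqmodP/asboolP.
by move=> uv; apply/eqmodP/asboolP.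
Qed.

Lemma pres_reprK : cancel (repr : presented -> word X) pres_pi.
Proof. exact: reprK. Qed.

Lemma pres_repr u : pres_cong (repr (pres_pi u)) u.
Proof. by apply/pres_piP; rewrite pres_reprK. Qed.

Lemma pres_mulE u v :
  pres_mul (pres_pi u) (pres_pi v) = pres_pi (u ++ v).
Proof. by apply/pres_piP; apply: PresCat; apply: pres_repr. Qed.

Lemma winvK : involutive winv.
Proof.
move=> u; rewrite /winv map_rev revK -map_comp -[RHS]map_id.
by apply: eq_map => -[x b] /=; rewrite negbK.
Qed.

Lemma winv_l u : pres_cong (winv u ++ u) [::].
Proof.
elim: u => [|[x b] u IHu]; first exact: PresRefl.
rewrite /winv /= rev_cons -cats1 -catA /= -[_ :: _ :: u]/([:: _; _] ++ u).
apply: PresTrans IHu; apply: PresCat; first exact: PresRefl.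
rewrite -[X in pres_cong _ X]cat0s; apply: PresCat; last exact: PresRefl.
by have := PresCancel x (~~ b); rewrite negbK.
Qed.

Lemma winv_r u : pres_cong (u ++ winv u) [::].
Proof. by have := winv_l (winv u); rewrite winvK. Qed.

Lemma pres_mulA : associative pres_mul.
Proof.
move=> a b c; rewrite -[a]pres_reprK -[b]pres_reprK -[c]pres_reprK.
by rewrite !pres_mulE catA.
Qed.

Lemma pres_mul1 : left_id pres_one pres_mul.
Proof. by move=> a; rewrite -[a]pres_reprK pres_mulE. Qed.

Lemma pres_1mul : right_id pres_one pres_mul.
Proof. by move=> a; rewrite -[a]pres_reprK pres_mulE cats0. Qed.

Lemma pres_mulV : left_inverse pres_one pres_inv pres_mul.
Proof.
by move=> a; rewrite -{2}[a]pres_reprK pres_mulE; apply/pres_piP/winv_l.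
Qed.

Lemma pres_Vmul : right_inverse pres_one pres_inv pres_mul.
Proof.
by move=> a; rewrite -{1}[a]pres_reprK pres_mulE; apply/pres_piP/winv_r.
Qed.

HB.instance Definition _ := isGroup.Build presented
  pres_mulA pres_mul1 pres_1mul pres_mulV pres_Vmul.

Definition pres_gen (x : X) : presented := pres_pi [:: (x, false)].

Lemma pres_ind (P : presented -> Prop) :
    P 1 -> (forall x a, P a -> P (pres_gen x * a)) ->
    (forall x a, P a -> P ((pres_gen x)^-1 * a)) ->
  forall a, P a.
Proof.
move=> P1 PM PV a; rewrite -[a]pres_reprK; elim: (repr a) => [|[x b] u IHu] //.
have -> : pres_pi ((x, b) :: u) = pres_pi [:: (x, b)] * pres_pi u.
  by rewrite -[RHS]/(pres_mul _ _) pres_mulE.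
case: b; last exact: PM.
suff -> : pres_pi [:: (x, true)] = (pres_gen x)^-1 by exact: PV.
apply: (@mulIg _ (pres_gen x)); rewrite mulVg -[LHS]/(pres_mul _ _) pres_mulE.
exact/pres_piP/(PresCancel x true).
Qed.

End Presentation.

Section Quotient.

Variable H : groupType.

Definition generated (S : H -> Prop) : {pred H} := fun z =>
  `[< forall K : {pred H}, group_closed K -> (forall s, S s -> s \in K) ->
      z \in K >].

Lemma generated_group S : group_closed (generated S).
Proof.
split; first by apply/asboolP => K [].
move=> x y /asboolP xS /asboolP yS; apply/asboolP => K gK SK.
by have [_ +] := gK; apply; [apply: xS | apply: yS].
Qed.

Lemma generated_sub (S : H -> Prop) s : S s -> s \in generated S.
Proof. by move=> Ss; apply/asboolP => K _; apply. Qed.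

Lemma generated_normal (S : H -> Prop) :
    (forall z s, S s -> S (lconjg z s)) ->
  forall z n, n \in generated S -> lconjg z n \in generated S.
Proof.
move=> nS z n /asboolP/(_ [pred m | lconjg z m \in generated S]); apply.
  have [S1 SV] := generated_group S; split.
    by rewrite inE /lconjg mulg1 mulgV.
  move=> x y; rewrite !inE => Sx Sy.
  suff -> : lconjg z (x * y^-1) = lconjg z x * (lconjg z y)^-1 by exact: SV.
  by rewrite /lconjg !invgM invgK !mulgA mulgKV.
by move=> s Ss; rewrite inE; apply/generated_sub/nS.
Qed.

Variables (N : {pred H}) (gN : group_closed N)
  (nN : forall z n, n \in N -> lconjg z n \in N).

Definition coset_eq : rel H := fun x y => x^-1 * y \in N.

Lemma coset_eq_refl : reflexive coset_eq.
Proof. by move=> x; rewrite /coset_eq mulVg; case: gN. Qed.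

Lemma coset_eq_sym : symmetric coset_eq.
Proof.
suff s x y : coset_eq x y -> coset_eq y x.
  by move=> x y; apply/idP/idP; apply: s.
by move=> /(group_closedV gN); rewrite invgM invgK.
Qed.

Lemma coset_eq_trans : transitive coset_eq.
Proof.
move=> y x z xy yz; have := group_closedM gN xy yz.
by rewrite -!mulgA mulKVg.
Qed.

Canonical coset_equiv :=
  EquivRel coset_eq coset_eq_refl coset_eq_sym coset_eq_trans.

(* The normality proof is a parameter of the type because the group structure
   on the quotient, declared below, depends on it. *)
Definition quotg of (forall z n, n \in N -> lconjg z n \in N) :=
  {eq_quot coset_equiv}.
Local Notation Q := (quotg nN).
HB.instance Definition _ := Choice.on Q.
HB.instance Definition _ := EqQuotient.on Q.

Definition quotg_pi (x : H) : Q := \pi_Q x.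
Definition quotg_mul (a b : Q) : Q := quotg_pi (repr a * repr b).
Definition quotg_inv (a : Q) : Q := quotg_pi (repr a)^-1.

Lemma quotg_piP x y : quotg_pi x = quotg_pi y <-> x^-1 * y \in N.
Proof. by split; [move/eqmodP | move=> ?; apply/eqmodP]. Qed.

Lemma quotg_reprK : cancel (repr : Q -> H) quotg_pi.
Proof. exact: reprK. Qed.

Lemma quotg_repr x : x^-1 * repr (quotg_pi x) \in N.
Proof. by apply/quotg_piP; rewrite quotg_reprK. Qed.

Lemma quotg_mulE x y : quotg_mul (quotg_pi x) (quotg_pi y) = quotg_pi (x * y).
Proof.
apply/esym/quotg_piP; set x' := repr _; set y' := repr _.
have Nx : x^-1 * x' \in N := quotg_repr x.
have Ny : y^-1 * y' \in N := quotg_repr y.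
have := group_closedM gN (nN y^-1 Nx) Ny.
by rewrite /lconjg invgK invgM !mulgA mulgK.
Qed.

Lemma quotg_mulA : associative quotg_mul.
Proof.
move=> a b c; rewrite -[a]quotg_reprK -[b]quotg_reprK -[c]quotg_reprK.
by rewrite !quotg_mulE mulgA.
Qed.

Lemma quotg_mul1 : left_id (quotg_pi 1) quotg_mul.
Proof. by move=> a; rewrite -[a]quotg_reprK quotg_mulE mul1g. Qed.

Lemma quotg_1mul : right_id (quotg_pi 1) quotg_mul.
Proof. by move=> a; rewrite -[a]quotg_reprK quotg_mulE mulg1. Qed.

Lemma quotg_mulV : left_inverse (quotg_pi 1) quotg_inv quotg_mul.
Proof.
by move=> a; rewrite -{2}[a]quotg_reprK quotg_mulE mulVg.
Qed.

Lemma quotg_Vmul : right_inverse (quotg_pi 1) quotg_inv quotg_mul.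
Proof.
by move=> a; rewrite -{1}[a]quotg_reprK quotg_mulE mulgV.
Qed.

HB.instance Definition _ := isGroup.Build Q
  quotg_mulA quotg_mul1 quotg_1mul quotg_mulV quotg_Vmul.

End Quotient.

Section TensorSquare.

Variable G : groupType.

Local Notation gen x h := ((x, h), false).

Inductive tensor_rel : word (G * G)%type -> word (G * G)%type -> Prop :=
| TensorRelL x y h :
    tensor_rel [:: gen (x * y) h] [:: gen (lconjg x y) (lconjg x h); gen x h]
| TensorRelR x h k :
    tensor_rel [:: gen x (h * k)] [:: gen x h; gen (lconjg h x) (lconjg h k)].

Definition tensor_square : groupType := presented tensor_rel.

Definition tensor (x h : G) : tensor_square := pres_gen tensor_rel (x, h).

Lemma tensorMl x y h :
  tensor (x * y) h = tensor (lconjg x y) (lconjg x h) * tensor x h.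
Proof.
by rewrite -[RHS]/(pres_mul _ _) pres_mulE; apply/pres_piP/PresRel/TensorRelL.
Qed.

Lemma tensorMr x h k :
  tensor x (h * k) = tensor x h * tensor (lconjg h x) (lconjg h k).
Proof.
by rewrite -[RHS]/(pres_mul _ _) pres_mulE; apply/pres_piP/PresRel/TensorRelR.
Qed.

Lemma lconjgM (x y z : G) : lconjg (x * y) z = lconjg x (lconjg y z).
Proof. by rewrite /lconjg invgM !mulgA. Qed.

Lemma lconjMg (x y z : G) : lconjg x (y * z) = lconjg x y * lconjg x z.
Proof. by rewrite /lconjg !mulgA mulgKV. Qed.

Lemma lconjgJ (x h z : G) :
  lconjg (lconjg x h) (lconjg x z) = lconjg (x * h) z.
Proof. by rewrite -lconjgM /lconjg mulgKV. Qed.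

Lemma lconj1g (x : G) : lconjg 1 x = x.
Proof. by rewrite /lconjg mul1g invg1 mulg1. Qed.

(* Brown-Loday: the tensor of x and h acts on the tensor square by conjugation
   as [x, h]; obtained by expanding tensor (x * y) (h * k) both ways. *)
Lemma tensorJ (x h a b : G) :
  lconjg (tensor x h) (tensor a b) =
  tensor (lconjg (lcommg x h) a) (lconjg (lcommg x h) b).
Proof.
have key y k :
    tensor (lconjg (x * h) y) (lconjg (x * h) k) * tensor x h =
    tensor x h * tensor (lconjg (h * x) y) (lconjg (h * x) k).
  have := tensorMl x y (h * k).
  rewrite (tensorMr (x * y) h k) (tensorMl x y h) (lconjMg h x y).
  rewrite (tensorMl (lconjg h x)) (lconjMg x h k) (tensorMr (lconjg x y)).
  rewrite (tensorMr x h k) !lconjgJ !mulgA => /mulIg.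
  by rewrite -!mulgA => /mulgI.
pose g := (h * x)^-1.
have := key (lconjg g a) (lconjg g b); rewrite -!lconjgM mulgV !lconj1g.
have -> : x * h * g = lcommg x h by rewrite /g invgM !mulgA.
by move=> e; rewrite {1}/lconjg -e mulgK.
Qed.

Definition is_diag (z : tensor_square) := exists x, z = tensor x x.

Definition nabla : {pred tensor_square} := generated is_diag.

Lemma nabla_group : group_closed nabla.
Proof. exact: generated_group. Qed.

Lemma is_diag_normal z s : is_diag s -> is_diag (lconjg z s).
Proof.
have JM (a b c : tensor_square) : lconjg (a * b) c = lconjg a (lconjg b c).
  by rewrite /lconjg invgM !mulgA.
elim/pres_ind: z s => [|[x h] a IHa|[x h] a IHa] s ds.
- by rewrite /lconjg mul1g invg1 mulg1.
- rewrite JM; have [y ->] := IHa s ds.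
  exists (lconjg (lcommg x h) y).
  by rewrite -[pres_gen _ _]/(tensor x h) tensorJ.
rewrite JM; have [y ->] := IHa s ds.
exists (lconjg (lcommg x h)^-1 y).
have := tensorJ x h (lconjg (lcommg x h)^-1 y) (lconjg (lcommg x h)^-1 y).
rewrite -!lconjgM mulgV !lconj1g => <-.
by rewrite -JM mulVg /lconjg mul1g invg1 mulg1.
Qed.

Lemma nabla_normal z n : n \in nabla -> lconjg z n \in nabla.
Proof. exact/generated_normal/is_diag_normal. Qed.

Definition exterior_square : groupType := quotg nabla_group nabla_normal.

Definition wedge (x y : G) : exterior_square :=
  quotg_pi nabla_group nabla_normal (tensor x y).

End TensorSquare.

Section Degrees.

Variable gT : finGroupType.

Definition tensor_degree : rat :=
  (#|[set p : gT * gT | tensor p.1 p.2 == 1%g]|%:R / (#|gT| ^ 2)%:R)%R.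

Definition exterior_degree : rat :=
  (#|[set p : gT * gT | wedge p.1 p.2 == 1%g]|%:R / (#|gT| ^ 2)%:R)%R.

Definition commutativity_degree : rat :=
  (#|[set p : gT * gT | lcommg p.1 p.2 == 1%g]|%:R / (#|gT| ^ 2)%:R)%R.

End Degrees.

(* Main.v *)
(** The map sending the tensor of x and h to [x, h] respects the defining
    relations of the tensor square, so it extends to a homomorphism from the
    tensor square to G; as [x, x] = 1 it kills nabla. Hence x ⊗ h = 1 implies
    x ∧ h = 1, which implies [x, h] = 1, and the three sets of pairs counted by
    the degrees are nested. *)
Require Import Defs.
From mathcomp Require Import all_boot all_order all_algebra all_fingroup.
From mathcomp Require Import generic_quotient boolp.

Set Implicit Arguments.
Unset Strict Implicit.
Unset Printing Implicit Defensive.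

Import Order.TTheory GRing.Theory Num.Theory.

Local Open Scope group_scope.

Definition word_eval (X : choiceType) (G : groupType) (f : X -> G)
    (u : word X) : G :=
  foldr (fun l z => (if l.2 then (f l.1)^-1 else f l.1) * z) 1 u.

Lemma word_eval_cat (X : choiceType) (G : groupType) (f : X -> G)
    (u v : word X) :
  word_eval f (u ++ v) = word_eval f u * word_eval f v.
Proof. by elim: u => [|l u IHu] /=; rewrite ?mul1g // IHu mulgA. Qed.

(** Universal property of a presentation: equality of values is itself a congruence that contains
    the free cancellations, so only [R] needs checking. *)
Lemma word_eval_cong (X : choiceType) (R : word X -> word X -> Prop)
    (G : groupType) (f : X -> G) :
    (forall u v, R u v -> word_eval f u = word_eval f v) ->
  forall u v, pres_cong R u v -> word_eval f u = word_eval f v.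
Proof.
move=> fR u v; elim=> {u v} [u v /fR //|x b||u v _ //|u v w _ -> _ //|].
- by case: b; rewrite /= mulg1 ?mulVg ?mulgV.
- by [].
- by move=> u u' v v' _ eu _ ev; rewrite !word_eval_cat eu ev.
Qed.

Section Commutator.

Variable G : groupType.

(** With [lcommMr], this provides the two defining relations that [word_eval_cong] requires of the
    commutator map. *)
Lemma lcommMl (x y h : G) :
  lcommg (x * y) h = lcommg (lconjg x y) (lconjg x h) * lcommg x h.
Proof. by rewrite /lcommg /lconjg !invgM !invgK !mulgA !mulgKV. Qed.

Lemma lcommMr (x h k : G) :
  lcommg x (h * k) = lcommg x h * lcommg (lconjg h x) (lconjg h k).
Proof. by rewrite /lcommg /lconjg !invgM !invgK !mulgA !mulgKV. Qed.

Definition tensor_comm (z : tensor_square G) : G :=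
  word_eval (fun p => lcommg p.1 p.2) (repr z).

Lemma tensor_comm_pi u :
  tensor_comm (pres_pi (@tensor_rel G) u) =
  word_eval (fun p => lcommg p.1 p.2) u.
Proof.
apply: word_eval_cong (pres_repr (@tensor_rel G) u) => _ _ [x y h|x h k] /=.
  by rewrite !mulg1 lcommMl.
by rewrite !mulg1 lcommMr.
Qed.

Lemma tensor_comm_tensor x h : tensor_comm (tensor x h) = lcommg x h.
Proof. by rewrite tensor_comm_pi /= mulg1. Qed.

Lemma tensor_comm1 : tensor_comm 1 = 1.
Proof. exact: tensor_comm_pi. Qed.

Lemma tensor_commM a b : tensor_comm (a * b) = tensor_comm a * tensor_comm b.
(* By definition [a * b] is the class of the concatenated representatives. *)
Proof. by rewrite [LHS]tensor_comm_pi word_eval_cat. Qed.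

Lemma tensor_commV a : tensor_comm a^-1 = (tensor_comm a)^-1.
Proof.
by apply: (@mulIg _ (tensor_comm a)); rewrite -tensor_commM !mulVg tensor_comm1.
Qed.

Lemma tensor_comm_nabla (z : tensor_square G) : z \in @nabla G -> tensor_comm z = 1.
Proof.
(* [nabla] lies in every subgroup containing the diagonal tensors; the kernel of [tensor_comm] is
   one. *)
move=> /asboolP/(_ [pred a | tensor_comm a == 1]) Kz; apply/eqP/Kz.
  split=> [|a b]; rewrite !inE; first by rewrite tensor_comm1.
  by rewrite tensor_commM tensor_commV => /eqP -> /eqP ->; rewrite mulgV.
by move=> _ [x ->]; rewrite inE tensor_comm_tensor /lcommg mulgK mulgV.
Qed.

Lemma tensor1_wedge1 (x y : G) : tensor x y = 1 -> wedge x y = 1.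
Proof. by rewrite /wedge => ->. Qed.

Lemma wedge1_lcomm1 (x y : G) : wedge x y = 1 -> lcommg x y = 1.
Proof.
(* With 1 on the left, the coset criterion puts [tensor x y] itself, not its inverse, in [nabla]. *)
move=> /esym/quotg_piP; rewrite invg1 mul1g => /tensor_comm_nabla.
by rewrite tensor_comm_tensor.
Qed.

End Commutator.

Theorem theorem2p7 (gT : finGroupType) :
  (tensor_degree gT <= exterior_degree gT <= commutativity_degree gT)%R.
Proof.
(* The denominators agree, so each inequality reduces to an inclusion of the counted sets. *)
apply/andP; split; apply: ler_wpM2r; rewrite ?invr_ge0 ?ler0n // ler_nat;
  apply/subset_leq_card/subsetP => p; rewrite !inE => /eqP.
  by move=> /tensor1_wedge1 ->.
by move=> /wedge1_lcomm1 ->.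
Qed.
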